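(* Let $K\subseteq\mathbb{R}^n$ be nonempty, closed and convex and let $f=(f_1,\dots,f_m):K\to\mathbb{R}^m$ be continuous. Suppose that all $f_i$ are strictly quasi-convex on $K$ and strictly bounded from below by $0$ on $K$ (i.e. $f_i(x)>0$ for all $x\in K$). Then $\operatorname{Sol}(K,f)=\operatorname{Sol}^w(K,f)$. Moreover, if $\operatorname{Sol}(K,f)$ is disconnected, then all its connected components are unbounded.
   Context: A point $x\in K$ is a Pareto solution (an element of $\operatorname{Sol}(K,f)$) if there is no $y\in K$ with $f(y)-f(x)\in-\mathbb{R}^m_+\setminus\{0\}$; it is a weak Pareto solution (an element of $\operatorname{Sol}^w(K,f)$) if there is no $y\in K$ with $f(y)-f(x)\in-\operatorname{int}\mathbb{R}^m_+$. A function $g:K\to\mathbb{R}$ is strictly quasi-convex on $K$ if $g(tx+(1-t)y)<\max\{g(x),g(y)\}$ for all $x\neq y$ in $K$ and all $t\in(0,1)$. *)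

(* Defs.v *)
From HB Require Import structures.
From mathcomp Require Export all_boot all_order all_algebra.
From mathcomp Require Export all_classical all_reals all_analysis.

Set Implicit Arguments.
Unset Strict Implicit.
Unset Printing Implicit Defensive.

Export Order.TTheory GRing.Theory Num.Theory numFieldNormedType.Exports.
Global Open Scope classical_set_scope.
Global Open Scope ring_scope.

Definition orthant (R : realType) (m : nat) : set 'rV[R]_m :=
  [set v | forall i : 'I_m, 0 <= v ord0 i].
Arguments orthant : clear implicits.

(* A map K -> R^m is represented by a total map on R^n; only its values on K
   are used. *)
Definition Sol (R : realType) (n m : nat) (K : set 'rV[R]_n)
    (f : 'rV[R]_n -> 'rV[R]_m) : set 'rV[R]_n :=
  [set x | K x /\
    ~ exists2 y, K y & ([set - v | v in orthant R m] `\ 0) (f y - f x)].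

Definition weakSol (R : realType) (n m : nat) (K : set 'rV[R]_n)
    (f : 'rV[R]_n -> 'rV[R]_m) : set 'rV[R]_n :=
  [set x | K x /\
    ~ exists2 y, K y & [set - v | v in interior (orthant R m)] (f y - f x)].

Definition strictly_quasiconvex_on (R : realType) (n : nat) (K : set 'rV[R]_n)
    (g : 'rV[R]_n -> R) : Prop :=
  forall x y : 'rV[R]_n, K x -> K y -> x != y ->
  forall t : R, 0 < t < 1 ->
    g (t *: x + (1 - t) *: y) < Num.max (g x) (g y).

(* Main.v *)
Require Import Defs.
From mathcomp Require Import lra.

(** The proof is by scalarization.  For a vector of positive weights [l], let
    [chebyshev l (f x) = max_i l_i * f_i x].  Because the [f_i] are positive,
    a weak Pareto point [x] minimizes this function for the weights
    [l_i = 1 / f_i x] ([weakSol_argmin]).  Conversely, strict quasi-convexity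
    makes every such minimizer a Pareto point, since the midpoint of [x] and a
    point dominating it would have a strictly smaller value ([argmin_Sol]).
    Hence both solution sets are the union, over the positive cone, of the
    sets [argmin K (chebyshev l \o f)].

    The scalarized functions are again strictly quasi-convex, so each of them
    has at most one minimizer, and the union is the image of a partially
    defined map from the positive cone to [K].  Two facts control this map.
    - Its domain is relatively open and the map is continuous
      ([argmin_stable]): if [x0] minimizes the function of [l0], then on a
      small sphere around [x0] that function exceeds its value at [x0] by a
      positive gap, which survives a small change of weights; quasi-convexity
      then keeps every better point inside the sphere.
    - A limit of weights whose minimizers stay in a compact set still has a
      minimizer ([argmin_closed]).

    Now suppose that a connected component [C] of the union is bounded.  The
    weights whose minimizer lies in [C] form a subset of the positive cone
    that is relatively open by the first fact and relatively closed by both.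
    The positive cone is convex, hence connected, so this subset is the whole
    cone; every minimizer then lies in [C], and the union is connected
    ([bounded_component_connected]). *)

Set Implicit Arguments.
Unset Strict Implicit.

(** * Convex sets, continuity and compactness *)

Lemma convex_setP (R : realType) (V : lmodType R) (A : set V) :
  convex_set (M := V) A <->
  forall x y (t : R), A x -> A y -> 0 <= t <= 1 -> A (t *: x + (1 - t) *: y).
Proof.
split=> [cA x y t Ax Ay /andP[t0 t1]|cA x y t /set_mem Ax /set_mem Ay].
  by have := cA x y (Itv01 t0 t1) (mem_set Ax) (mem_set Ay); rewrite inE.
rewrite inE; apply: cA => //.
by rewrite ge0 le1.
Qed.

Lemma convex_open_segment (R : realType) (V : lmodType R) (A : set V) x y
    (t : R) :
  convex_set (M := V) A -> A x -> A y -> 0 < t < 1 ->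
  A (t *: x + (1 - t) *: y).
Proof.
by move=> /convex_setP cA Ax Ay /andP[/ltW t0 /ltW t1]; apply: cA; rewrite ?t0.
Qed.

(** A nonempty convex set is the union of the segments from one of its points,
    each of which is a continuous image of the unit interval. *)
Lemma convex_connected (R : realType) (V : normedModType R) (A : set V) :
  convex_set (M := V) A -> connected A.
Proof.
move=> /convex_setP cA.
have [->|/set0P[x Ax]] := eqVneq A set0; first exact: connected0.
pose seg y := [set t *: x + (1 - t) *: y | t in `[(0 : R), 1]%classic].
have itvP t : `[(0 : R), 1]%classic t = (0 <= t <= 1) :> Prop.
  by rewrite /= in_itv.
have -> : A = \bigcup_(y in A) seg y.
  apply/seteqP; split=> [y Ay|z [y Ay [t]]].
    exists y => //; exists 0; first by rewrite itvP lexx ler01.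
    by rewrite scale0r add0r subr0 scale1r.
  by rewrite itvP => t01 <-; exact: cA.
apply: bigcup_connected => [|y Ay].
  exists x => y Ay; exists 1; first by rewrite itvP lexx ler01.
  by rewrite subrr scale0r addr0 scale1r.
apply: connected_continuous_connected; first exact: segment_connected.
apply: continuous_subspaceT => t; apply: cvgD.
- by apply: cvgZr_tmp; exact: cvg_id.
- by apply: cvgZr_tmp; apply: cvgB; [exact: cvg_cst|exact: cvg_id].
Qed.

Lemma dist_continuous (R : realType) (V : normedModType R) (c : V) :
  continuous (fun y => `|y - c|).
Proof.
by move=> y; apply: cvg_norm; apply: cvgB; [exact: cvg_id|exact: cvg_cst].
Qed.

Lemma lipschitz_continuous (R : realType) (V W : normedModType R)
    (F : V -> W) k :
  (forall v w, `|F v - F w| <= k * `|v - w|) -> continuous F.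
Proof.
move=> Fk v; apply/cvgrPdist_lt => e e0.
have M0 : 0 < `|k| + 1 by rewrite ltr_wpDl.
apply/nbhs_ballP; exists (e / (`|k| + 1)) => [|w]; first exact: divr_gt0.
rewrite -ball_normE /= ltr_pdivlMr// mulrC.
apply: le_lt_trans; apply: le_trans (Fk v w) _.
by rewrite ler_wpM2r// ler_wpDr// ler_norm.
Qed.

Lemma compact_setI_norm_le (R : realType) (n : nat) (A : set 'rV[R]_n) c r :
  closed A -> compact (A `&` [set y | `|y - c| <= r]).
Proof.
move=> clA; apply: bounded_closed_compact.
  exists (r + `|c|); split => [|b /ltW rb y [_ /= yr]]; first exact: num_real.
  rewrite -[y](subrK c) (le_trans (ler_normD _ _))// (le_trans _ rb)//.
  by rewrite lerD2r.
apply: closedI => //.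
by apply: (closed_comp _ (@closed_le _ r)) => y _; exact: dist_continuous.
Qed.

(** * Minimizers of a parametrized family of strictly quasi-convex functions *)

Definition argmin (R : realType) (T : Type) (K : set T) (g : T -> R) : set T :=
  [set x | K x /\ forall y, K y -> g x <= g y].

Lemma compact_argmin_neq0 (R : realType) (T : topologicalType) (K B : set T)
    (g : T -> R) :
  {within K, continuous g} -> compact B -> B `<=` K -> B !=set0 ->
  argmin B g !=set0.
Proof.
move=> gK Bc BK B0.
have [x /set_mem Bx xmin] := compact_EVT_min B0 Bc (continuous_subspaceW BK gK).
by exists x; split => // y By; apply: xmin; rewrite inE.
Qed.

(** The weights are replaced by a convex set [L] of parameters in a normed
    space.  The only link between the functions [g l] is that they are
    Lipschitz in [l], with a constant [h y] that is bounded on compact subsets of [K]. *)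
Section ParametricArgmin.
Context {R : realType} {n : nat} {V : normedModType R}.
Variables (K : set 'rV[R]_n) (L : set V).
Variables (g : V -> 'rV[R]_n -> R) (h : 'rV[R]_n -> R).
Hypotheses (Kclosed : closed K) (Kconvex : convex_set (M := 'rV[R]_n) K).
Hypothesis Lconvex : convex_set (M := V) L.
Hypothesis gcont : forall l, L l -> {within K, continuous (g l)}.
Hypothesis gqc : forall l, L l -> strictly_quasiconvex_on K (g l).
Hypothesis hcont : {within K, continuous h}.
Hypothesis g_lip : forall l l' y, L l -> L l' -> K y ->
  `|g l y - g l' y| <= `|l - l'| * h y.

(** The midpoint of two minimizers would do strictly better. *)
Lemma argmin_unique l x y :
  L l -> argmin K (g l) x -> argmin K (g l) y -> x = y.
Proof.
move=> Ll [Kx xmin] [Ky ymin]; apply/eqP; apply: contrapT => /negP xy.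
have half01 : 0 < (2^-1 : R) < 1 by rewrite invr_gt0 ltr0n invf_lt1 ?ltr1n.
have := gqc Ll Kx Ky xy half01.
have gxy : g l x = g l y by apply/eqP; rewrite eq_le xmin// ymin.
by rewrite gxy maxxx ltNge ymin//; exact: convex_open_segment.
Qed.

(** A point [y] outside the ball with [g l y < g l x0] would, by
    quasi-convexity along the segment from [x0] to [y], give a point of the
    sphere where [g l] is at most [g l x0]. *)
Lemma argmin_local_global l x0 x r : L l -> K x0 -> 0 < r ->
  argmin (K `&` [set y | `|y - x0| <= r]) (g l) x ->
  (forall y, K y -> `|y - x0| = r -> g l x0 < g l y) ->
  argmin K (g l) x.
Proof.
move=> Ll Kx0 r0 [[Kx xr] xmin] sph; split => // y Ky.
have [yr|yr] := leP `|y - x0| r; first by apply: xmin; split.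
have gx : g l x <= g l x0.
  by apply: xmin; split => //=; rewrite subrr normr0 ltW.
rewrite leNgt; apply/negP => gyx.
have d0 : 0 < `|y - x0| by exact: lt_trans yr.
pose t := r / `|y - x0|.
have t01 : 0 < t < 1 by rewrite divr_gt0//= ltr_pdivrMr// mul1r.
pose z := t *: y + (1 - t) *: x0.
have Kz : K z by exact: convex_open_segment.
have zx0 : z - x0 = t *: (y - x0).
  by rewrite /z -addrA scalerBr scalerBl scale1r addrAC subrr sub0r.
have zr : `|z - x0| = r.
  by rewrite zx0 normrZ gtr0_norm ?(andP t01).1// /t divfK// gt_eqF.
have yx0 : y != x0 by rewrite -subr_eq0 -normr_gt0.
have := gqc Ll Ky Kx0 yx0 t01.
rewrite ltNge => /negP; apply.
rewrite ge_max !ltW ?sph//.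
exact: (lt_le_trans gyx (le_trans gx (ltW (sph _ Kz zr)))).
Qed.

Lemma g_bound_compact B : compact B -> B `<=` K ->
  exists2 H, 0 < H & forall l l' y, L l -> L l' -> B y ->
    `|g l y - g l' y| <= `|l - l'| * H.
Proof.
move=> Bc BK.
have /compact_bounded/ex_strict_bound_gt0[H H0 hH] : compact (h @` B).
  by apply: continuous_compact => //; exact: continuous_subspaceW hcont.
exists H => // l l' y Ll Ll' By.
apply: le_trans (g_lip Ll Ll' (BK _ By)) _; apply: ler_wpM2l => //.
by apply: le_trans (ler_norm _) _; apply/ltW/hH; exists y.
Qed.

(** Openness of the set of parameters that have a minimizer, and continuity of
    the minimizer, in one statement. *)
Lemma argmin_stable l0 x0 r : L l0 -> argmin K (g l0) x0 -> 0 < r ->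
  exists2 d, 0 < d & forall l, L l -> `|l - l0| < d ->
    exists2 x, argmin K (g l) x & `|x - x0| <= r.
Proof.
move=> Ll0 [Kx0 x0min] r0.
pose B := K `&` [set y | `|y - x0| <= r].
have Bc : compact B by exact: compact_setI_norm_le.
have BK : B `<=` K by exact: subIsetl.
have Bx0 : B x0 by split => //=; rewrite subrr normr0 ltW.
pose S := B `&` [set y | r <= `|y - x0|].
have [e e0 gap] : exists2 e, 0 < e & forall y, S y -> g l0 x0 + e <= g l0 y.
  (* The sphere may be empty, for instance when K is the single point x0; any
     gap is then suitable. *)
  have [S0|S0] := pselect (S !=set0); last first.
    by exists 1 => // y Sy; case: S0; exists y.
  have Sc : compact S.
    apply: compact_closedI => //.
    by apply: (closed_comp _ (@closed_ge _ r)) => y _; exact: dist_continuous.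
  have [s [Ss smin]] : argmin S (g l0) !=set0.
    by apply: compact_argmin_neq0 (gcont Ll0) Sc _ S0 => y [[]].
  exists (g l0 s - g l0 x0) => [|y Sy]; last by rewrite addrC subrK smin.
  have [[Ks sr] rs] := Ss.
  rewrite subr_gt0 lt_neqAle x0min// andbT; apply/negP => /eqP gx0s.
  have sx0 : s = x0.
    by apply: (argmin_unique Ll0); split => // y Ky; rewrite -gx0s x0min.
  by move: rs => /=; rewrite sx0 subrr normr0 leNgt r0.
have [H H0 gH] := g_bound_compact Bc BK.
(* With this radius every value on the ball changes by less than half of the
   gap, both at x0 and on the sphere. *)
exists (e / (2 * H)); first by rewrite divr_gt0// mulr_gt0.
move=> l Ll ld.
have gclose y : B y -> `|g l y - g l0 y| < e / 2.
  move=> By; apply: le_lt_trans (gH _ _ _ Ll Ll0 By) _.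
  by move: ld; rewrite invfM mulrA ltr_pdivlMr.
have [x xB] := compact_argmin_neq0 (gcont Ll) Bc BK (ex_intro _ x0 Bx0).
exists x; last by case: xB => -[].
apply: (argmin_local_global Ll Kx0 r0 xB) => y Ky yr.
have Sy : S y by split; [split => //=; rewrite yr|rewrite /= yr].
have := gap _ Sy; have := gclose _ Bx0; have := gclose _ Sy.1.
rewrite !ltr_norml => /andP[+ _] /andP[_].
lra.
Qed.

(** The minimizer on [B] is compared with an arbitrary [y] in [K] by going
    through a nearby parameter [l'] whose global minimizer is in [B]; the two
    changes of parameter cost at most [`|l - l'| * (H + `|h y|)], which is
    arbitrarily small. *)
Lemma argmin_closed (B : set 'rV[R]_n) l : compact B -> B `<=` K -> L l ->
  closure [set l' | L l' /\ argmin K (g l') `&` B !=set0] l ->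
  argmin K (g l) `&` B !=set0.
Proof.
move=> Bc BK Ll clo.
have [H H0 gH] := g_bound_compact Bc BK.
have approx d : 0 < d ->
    exists l' x, [/\ L l', argmin K (g l') x, B x & `|l - l'| < d].
  move=> d0; have [l' [[Ll' [x [xmin Bx]]] ll']] := clo _ (nbhsx_ballx l d d0).
  by exists l', x; split => //; move: ll'; rewrite -ball_normE.
have B0 : B !=set0 by have [l' [x [_ _ ? _]]] := approx _ ltr01; exists x.
have [x [Bx xmin]] := compact_argmin_neq0 (gcont Ll) Bc BK B0.
exists x; split => //; split => [|y Ky]; first exact: BK.
apply/ler_addgt0Pr => e e0.
pose M := H + `|h y|.
have M0 : 0 < M by rewrite ltr_wpDr.
have [l' [x' [Ll' [Kx' x'min] Bx' ll']]] := approx (e / M) (divr_gt0 e0 M0).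
have gx' := gH _ _ _ Ll Ll' Bx'.
have gy : `|g l y - g l' y| <= `|l - l'| * `|h y|.
  by apply: le_trans (g_lip Ll Ll' Ky) _; rewrite ler_wpM2l// ler_norm.
have : `|l - l'| * M < e by rewrite -ltr_pdivlMr.
rewrite mulrDr => llM.
have := xmin _ Bx'; have := x'min _ Ky; move: gx' gy llM.
rewrite !ler_norml => /andP[_ +] /andP[+ _].
lra.
Qed.

Let sol := \bigcup_(l in L) argmin K (g l).

(** Parameters near [l0] form a convex set on which the minimizer is a
    continuous function, so the image of this set is a connected part of
    [sol] that contains [x0]. *)
Lemma argmin_locally_connected l0 x0 : L l0 -> argmin K (g l0) x0 ->
  exists2 d, 0 < d & forall l, L l -> `|l - l0| < d ->
    exists2 x, argmin K (g l) x & connected_component sol x0 x.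
Proof.
move=> Ll0 x0min.
have [d d0 dP] := argmin_stable Ll0 x0min ltr01.
exists d => // l1 Ll1 l1d.
pose U := L `&` ball l0 d.
pose xi l := xget 0 (argmin K (g l)).
have xiP l : U l -> argmin K (g l) (xi l).
  move=> [Ll ld]; apply: xgetPex.
  have [||x ? _] := dP l => //; last by exists x.
  by move: ld; rewrite -ball_normE /= distrC.
have Uconvex : convex_set (M := V) U.
  apply/convex_setP => u v t [Lu ud] [Lv vd] t01.
  split; first by move/convex_setP : Lconvex; apply.
  move: ud vd t01; rewrite -!ball_normE /= => ud vd /andP[t0 t1].
  have -> : l0 - (t *: u + (1 - t) *: v) = t *: (l0 - u) + (1 - t) *: (l0 - v).
    rewrite !scalerBr addrACA -opprD; congr (_ - _).
    by rewrite -scalerDl addrC subrK scale1r.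
  apply: le_lt_trans (ler_normD _ _) _.
  rewrite !normrZ !ger0_norm ?subr_ge0//.
  have uvd : Num.max `|l0 - u| `|l0 - v| < d by rewrite gt_max ud.
  apply: le_lt_trans uvd; set e := Num.max _ _.
  rewrite [leRHS](_ : e = t * e + (1 - t) * e); last first.
    by rewrite -mulrDl addrC subrK mul1r.
  by rewrite lerD// ler_wpM2l ?subr_ge0// /e le_max lexx ?orbT.
have xi_cont : {within U, continuous xi}.
  apply/subspace_continuousP => u Uu; apply/cvgrPdistC_le => e e0.
  have [d' d'0 d'P] := argmin_stable Uu.1 (xiP u Uu) e0.
  rewrite near_withinE; near=> l => Ul.
  have ld' : `|l - u| < d'.
    near: l; apply/nbhs_ballP; exists d' => // l.
    by rewrite -ball_normE /= distrC.
  have [x xmin xe] := d'P l Ul.1 ld'.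
  by rewrite /from_subspace (argmin_unique Ul.1 (xiP l Ul) xmin).
have Ul0 : U l0 by split => //; exact: ballxx.
have Ul1 : U l1 by split => //; rewrite -ball_normE /= distrC.
exists (xi l1); first exact: xiP.
exists (xi @` U); last by exists l1.
split.
- by exists l0 => //; exact: argmin_unique Ll0 (xiP _ Ul0) x0min.
- by move=> _ [l Ul <-]; exists l; [exact: Ul.1|exact: xiP].
- by apply: connected_continuous_connected => //; exact: convex_connected.
Unshelve. all: by end_near. Qed.

Lemma bounded_component_connected x0 :
  sol x0 -> bounded_set (connected_component sol x0) -> connected sol.
Proof.
move=> solx0 /ex_strict_bound_gt0[M _ bM].
pose C := connected_component sol x0.
pose D := [set l | L l /\ argmin K (g l) `&` C !=set0].
have DL : D `<=` L by move=> l [].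
suff LD : D = L.
  have -> : sol = C.
    apply/seteqP; split; last exact: connected_component_sub.
    move=> x [l Ll xmin]; have [_ [y [ymin Cy]]] : D l by rewrite LD.
    by rewrite (argmin_unique Ll xmin ymin).
  exact: component_connected.
(* Membership in D is locally constant around each parameter that has a
   minimizer. *)
have Dloc l0 x : L l0 -> argmin K (g l0) x ->
    \forall l \near l0, L l -> (D l <-> C x).
  move=> Ll0 xmin; have [d d0 dP] := argmin_locally_connected Ll0 xmin.
  apply/nbhs_ballP; exists d => //= l; rewrite -ball_normE/= distrC => ld Ll.
  have [y ymin xy] := dP l Ll ld; split.
    move=> [_ [y' [y'min Cy']]].
    apply: connected_component_trans Cy' _; apply: connected_component_sym.
    by rewrite (argmin_unique Ll y'min ymin).
  move=> Cx; split => //; exists y; split => //.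
  exact: connected_component_trans Cx xy.
apply: (convex_connected Lconvex).
- have [l0 Ll0 x0min] := solx0.
  exists l0; split => //; exists x0; split => //.
  exact: connected_component_refl.
- exists (interior [set l | L l -> D l]); first exact: open_interior.
  apply/seteqP; split=> [l Dl|l [Ll /interior_subset]]; last exact.
  split; first exact: DL.
  have [Ll [x [xmin Cx]]] := Dl.
  by apply: filterS (Dloc _ _ Ll xmin) => l' + Ll' => /(_ Ll') ->.
(* A limit l of D has a minimizer because those along D stay in the compact
   set B; local constancy of D around l then places it in C. *)
- exists (closure D); first exact: closed_closure.
  apply/seteqP; split=> [l Dl|l [Ll clD]].
    by split; [exact: DL|exact: subset_closure].
  pose B := K `&` [set y | `|y - 0| <= M].
  have [x [xmin _]] : argmin K (g l) `&` B !=set0.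
    apply: argmin_closed => //; [exact: compact_setI_norm_le|exact: subIsetl|].
    apply: (closureS _ clD) => l' [Ll' [x [xmin Cx]]].
    split => //; exists x; split => //; split; first exact: xmin.1.
    by rewrite /= subr0; exact/ltW/bM.
  have [l' [Dl' Dl'P]] := clD _ (Dloc _ _ Ll xmin).
  by split => //; exists x; split => //; apply/(Dl'P (DL _ Dl')).
Qed.

End ParametricArgmin.

(** * Weighted Chebyshev scalarization *)

Lemma rV_norm_coord_le (R : realDomainType) (m : nat) (u : 'rV[R]_m) i :
  `|u ord0 i| <= `|u|.
Proof.
by rewrite [leRHS]mx_normrE (le_bigmax 0 (fun ij => `|u ij.1 ij.2|) (ord0, i)).
Qed.

Lemma rV_norm_le (R : realDomainType) (m : nat) (u : 'rV[R]_m) c :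
  0 <= c -> (forall i, `|u ord0 i| <= c) -> `|u| <= c.
Proof.
move=> c0 uc; rewrite [leLHS]mx_normrE; apply: bigmax_le => // -[k i] _ /=.
by rewrite ord1.
Qed.

Lemma rV_norm_lt (R : realDomainType) (m : nat) (u : 'rV[R]_m) c :
  0 < c -> (forall i, `|u ord0 i| < c) -> `|u| < c.
Proof.
move=> c0 uc; rewrite [ltLHS]mx_normrE; apply: bigmax_lt => // -[k i] _ /=.
by rewrite ord1.
Qed.

Definition hadamard (R : realType) (m : nat) (l v : 'rV[R]_m) : 'rV[R]_m :=
  \row_i (l ord0 i * v ord0 i).

Lemma hadamard_norm_le (R : realType) (m : nat) (l v : 'rV[R]_m) :
  `|hadamard l v| <= `|l| * `|v|.
Proof.
apply: rV_norm_le => [|i]; first exact: mulr_ge0.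
by rewrite mxE normrM ler_pM ?rV_norm_coord_le.
Qed.

Lemma hadamardBl (R : realType) (m : nat) (l l' v : 'rV[R]_m) :
  hadamard (l - l') v = hadamard l v - hadamard l' v.
Proof. by apply/rowP => i; rewrite !mxE mulrBl. Qed.

Lemma hadamardBr (R : realType) (m : nat) (l v v' : 'rV[R]_m) :
  hadamard l (v - v') = hadamard l v - hadamard l v'.
Proof. by apply/rowP => i; rewrite !mxE mulrBr. Qed.

Definition positive_cone (R : realType) (m : nat) : set 'rV[R]_m :=
  [set v | forall i : 'I_m, 0 < v ord0 i].
Arguments positive_cone : clear implicits.

(** An interior vector is strictly positive because it stays in the orthant
    when a small constant is subtracted from all its coordinates; conversely,
    finitely many strict inequalities persist nearby. *)
Lemma interior_orthant (R : realType) (m : nat) :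
  interior (orthant R m) = positive_cone R m.
Proof.
apply/seteqP; split=> v.
  move=> /nbhs_ballP[e /= e0 ve] i.
  have : orthant R m (v - const_mx (e / 2)).
    apply: ve; rewrite -ball_normE /= opprD addrA subrr add0r opprK.
    apply: rV_norm_lt => // j; rewrite mxE gtr0_norm; lra.
  by move=> /(_ i); rewrite !mxE; lra.
move=> v0.
have v_ge0 i : \forall w \near v, 0 <= (w : 'rV[R]_m) ord0 i.
  exact: (cvgr_ge _ (@coord_continuous R 1 m ord0 i v) _ (v0 i)).
exact: (filter_forall _ v_ge0).
Qed.

Lemma positive_cone_convex (R : realType) (m : nat) :
  convex_set (M := 'rV[R]_m) (positive_cone R m).
Proof.
apply/convex_setP => u v t u0 v0 /andP[t0 t1] i; rewrite !mxE.
have := u0 i; have := v0 i; nra.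
Qed.

(** The norm of a row vector is the largest absolute value of its entries, so
    for positive [l] and [v] this is [max_i l_i * v_i]. *)
Definition chebyshev (R : realType) (m : nat) (l v : 'rV[R]_m) : R :=
  `|hadamard l v|.

Lemma chebyshev_lt (R : realType) (m : nat) (l v : 'rV[R]_m) c :
  (0 < m)%N -> positive_cone R m l -> positive_cone R m v ->
  chebyshev l v < c <-> forall i, l ord0 i * v ord0 i < c.
Proof.
move=> m0 l0 v0.
have lv i : `|hadamard l v ord0 i| = l ord0 i * v ord0 i.
  by rewrite mxE gtr0_norm// mulr_gt0.
split=> [lvc i|lvc].
  by rewrite -lv (le_lt_trans _ lvc)// rV_norm_coord_le.
apply: rV_norm_lt => [|i]; last by rewrite lv.
by apply: le_lt_trans (lvc (Ordinal m0)); rewrite mulr_ge0// ltW.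
Qed.

Lemma chebyshev_continuous (R : realType) (m : nat) (l : 'rV[R]_m) :
  continuous (chebyshev l).
Proof.
apply: (lipschitz_continuous (k := `|l|)) => v w.
apply: le_trans (ler_dist_dist _ _) _; rewrite -hadamardBr.
exact: hadamard_norm_le.
Qed.

(** * Pareto points as minimizers *)

Section Pareto.
Context {R : realType} {n m : nat}.
Variables (K : set 'rV[R]_n) (f : 'rV[R]_n -> 'rV[R]_m).
Hypothesis m_gt0 : (0 < m)%N.
Hypothesis Kconvex : convex_set (M := 'rV[R]_n) K.
Hypothesis fqc :
  forall i : 'I_m, strictly_quasiconvex_on K (fun x => f x ord0 i).
Hypothesis fpos : forall x, K x -> positive_cone R m (f x).

Lemma chebyshev_qc l : positive_cone R m l ->
  strictly_quasiconvex_on K (fun x => chebyshev l (f x)).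
Proof.
move=> l0 x y Kx Ky xy t t01.
have Kz := convex_open_segment Kconvex Kx Ky t01.
apply/(chebyshev_lt _ m_gt0 l0 (fpos Kz)) => i.
have coord u : K u -> l ord0 i * f u ord0 i <= chebyshev l (f u).
  move=> Ku; apply: le_trans (rV_norm_coord_le _ i).
  by rewrite mxE ler_norm.
apply: lt_le_trans (_ : l ord0 i * Num.max (f x ord0 i) (f y ord0 i) <= _).
  by rewrite ltr_pM2l//; exact: fqc.
by rewrite (maxr_pMr _ _ (ltW (l0 i))) ge_max !le_max !coord ?orbT.
Qed.

Lemma SolP x : Sol K f x <-> K x /\ forall y, K y ->
  (forall i, f y ord0 i <= f x ord0 i) -> f y = f x.
Proof.
split=> -[Kx xP]; split => //.
  move=> y Ky yx; apply: contrapT => fyx; apply: xP; exists y => //.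
  split; last by move=> /eqP; rewrite subr_eq0 => /eqP.
  exists (f x - f y); last by rewrite opprB.
  by move=> i; rewrite !mxE subr_ge0.
move=> [y Ky [[v v0 vE] fyx]]; apply: fyx => /=; apply/eqP.
rewrite subr_eq0; apply/eqP/xP => // i.
have := congr1 (fun w : 'rV_m => w ord0 i) vE; rewrite !mxE.
by have := v0 i; lra.
Qed.

Lemma weakSolP x : weakSol K f x <-> K x /\ forall y, K y ->
  exists i, f x ord0 i <= f y ord0 i.
Proof.
rewrite /weakSol interior_orthant; split=> -[Kx xP]; split => //.
  move=> y Ky; apply: contrapT => yx; apply: xP; exists y => //.
  exists (f x - f y); last by rewrite opprB.
  move=> i; rewrite !mxE subr_gt0 ltNge; apply/negP => ?.
  by apply: yx; exists i.
move=> [y Ky [v v0 vE]]; have [i] := xP y Ky.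
have := congr1 (fun w : 'rV_m => w ord0 i) vE; rewrite !mxE.
by have := v0 i; lra.
Qed.

Lemma Sol_weakSol : Sol K f `<=` weakSol K f.
Proof.
move=> x /SolP[Kx xP]; apply/weakSolP; split => // y Ky.
apply: contrapT => yx.
have fyx i : f y ord0 i < f x ord0 i.
  by rewrite ltNge; apply/negP => ?; apply: yx; exists i.
have := fyx (Ordinal m_gt0).
by rewrite (xP y Ky) ?ltxx// => i; exact: ltW.
Qed.

(** With the weights [l_i = 1 / f_i x] the scalarized function has value 1 at
    [x], and a value less than 1 at [y] means that [y] dominates [x] strictly
    in every coordinate. *)
Lemma weakSol_argmin :
  weakSol K f `<=`
  \bigcup_(l in positive_cone R m) argmin K (fun x => chebyshev l (f x)).
Proof.
move=> x /weakSolP[Kx xP].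
pose l : 'rV[R]_m := \row_i (f x ord0 i)^-1.
have l0 : positive_cone R m l by move=> i; rewrite mxE invr_gt0; exact: fpos.
exists l => //; split => // y Ky; rewrite leNgt; apply/negP.
have -> : chebyshev l (f x) = 1.
  have hE : hadamard l (f x) = const_mx 1.
    by apply/rowP => i; rewrite !mxE mulVf// gt_eqF//; exact: fpos.
  rewrite /chebyshev hE; apply/eqP; rewrite eq_le; apply/andP; split.
    by apply: rV_norm_le => // i; rewrite mxE normr1.
  have := rV_norm_coord_le (const_mx 1 : 'rV[R]_m) (Ordinal m_gt0).
  by rewrite mxE normr1.
move=> /(chebyshev_lt _ m_gt0 l0 (fpos Ky)) lt1.
have [i] := xP y Ky; rewrite leNgt => /negP; apply.
by have := lt1 i; rewrite mxE mulrC ltr_pdivrMr ?mul1r//; exact: fpos.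
Qed.

(** If [y != x] satisfies [f y <= f x], then at the midpoint of [x] and [y]
    every coordinate is strictly below its value at [x], which contradicts the
    minimality of [x]. *)
Lemma argmin_Sol :
  \bigcup_(l in positive_cone R m) argmin K (fun x => chebyshev l (f x))
  `<=` Sol K f.
Proof.
move=> x [l l0 [Kx xmin]]; apply/SolP; split => // y Ky yx.
have [->//|yNx] := eqVneq y x.
have half01 : 0 < (2^-1 : R) < 1 by rewrite invr_gt0 ltr0n invf_lt1 ?ltr1n.
have Kz := convex_open_segment Kconvex Ky Kx half01.
have := xmin _ Kz; rewrite leNgt => /negP; case.
apply/(chebyshev_lt _ m_gt0 l0 (fpos Kz)) => i.
apply: lt_le_trans (_ : l ord0 i * f x ord0 i <= _).
  rewrite ltr_pM2l//; have := fqc i Ky Kx yNx half01.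
  by rewrite (max_idPr (yx i)).
by apply: le_trans (rV_norm_coord_le _ i); rewrite mxE ler_norm.
Qed.

End Pareto.

Unset Implicit Arguments.

Theorem corollary6p2 (R : realType) (n m : nat) (hm : (0 < m)%N)
    (K : set 'rV[R]_n) (f : 'rV[R]_n -> 'rV[R]_m)
    (K0 : K !=set0) (Kclosed : closed K)
    (Kconvex : convex_set (M := 'rV[R]_n) K)
    (fcont : {within K, continuous f})
    (fqc : forall i : 'I_m, strictly_quasiconvex_on K (fun x => f x ord0 i))
    (fpos : forall (i : 'I_m) (x : 'rV[R]_n), K x -> 0 < f x ord0 i) :
  Sol K f = weakSol K f /\
  (~ connected (Sol K f) ->
   forall x : 'rV[R]_n, Sol K f x ->
     ~ bounded_set (connected_component (Sol K f) x)).
Proof.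
have fpos' x : K x -> positive_cone R m (f x) by move=> Kx i; exact: fpos.
pose g l x := chebyshev l (f x).
have wS := weakSol_argmin hm fpos'.
have aS := argmin_Sol hm Kconvex fqc fpos'.
have SolE : Sol K f = \bigcup_(l in positive_cone R m) argmin K (g l).
  by apply/seteqP; split => // x /(Sol_weakSol hm)/wS.
split.
  by apply/seteqP; split=> [|x /wS/aS//]; exact: Sol_weakSol.
rewrite SolE => Sol_disconnected x Solx Cbounded; apply: Sol_disconnected.
have within_comp (p : 'rV[R]_m -> R) :
    continuous p -> {within K, continuous (fun y => p (f y))}.
  by move=> pc y; apply: continuous_comp; [exact: fcont|exact: pc].
apply: (bounded_component_connected Kclosed Kconvex
  (positive_cone_convex (m := m)) _ _ (h := fun y => `|f y|) _ _ Solx Cbounded).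
- by move=> l _; apply: within_comp; exact: chebyshev_continuous.
- by move=> l l0; exact: chebyshev_qc.
- by apply: within_comp; exact: norm_continuous.
- move=> l l' y _ _ _; apply: le_trans (ler_dist_dist _ _) _.
  by rewrite -hadamardBl; exact: hadamard_norm_le.
Qed.
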